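(* Suppose Assumptions A1, A2 and A3 (stated in the context) hold, and consider the asynchronous and exact version of the dual decomposition algorithm described in the context, i.e. with $\varepsilon_D=0$, run with step size satisfying $$0<\alpha<\min\left\{\frac{1}{(2k_0+1/2)L_D},\frac{1}{2L_D}\right\}.$$ Then for all $k\in\mathcal{K}$: $$\left\|[A\bar{\bm{x}}^k-\bm{b}]^+\right\|\le\frac{M_1}{k+1},$$ $$-\frac{M_1\|\bm{\lambda}^*\|}{k+1}\le F(\bar{\bm{x}}^k)-F^*\le\frac{N_1}{k+1},$$ $$0\le D^*-D(\bar{\bm{\lambda}}^{k+1})\le\frac{N_1'}{k+1},$$ $$\|\bar{\bm{x}}^k-\bm{x}^*\|^2\le\frac{2(N_1+\|\bm{\lambda}^*\|M_1)}{c_F(k+1)}.$$ Here, with $\gamma_\alpha=\frac1\alpha-(2k_0+\frac12)L_D$, $$M_1=\frac{k_0+1}{\alpha}\left(2\|\bm{\lambda}^*\|+\|\bm{\lambda}^0\|+2\sqrt{\frac{2k_0(D^*-D^0)}{\gamma_\alpha}}\right),$$ $$N_1=\frac{k_0+1}{2\alpha}\left(\|\bm{\lambda}^0\|^2+\frac{8k_0(D^*-D^0)}{\gamma_\alpha}\right),\qquad N_1'=\frac{k_0+1}{2\alpha}\left(\|\bm{\lambda}^0-\bm{\lambda}^*\|^2+\frac{8k_0(D^*-D^0)}{\gamma_\alpha}\right).$$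
   Context: Notation: $\|\cdot\|$ is the Euclidean norm on vectors, $\|\cdot\|_F$ the Frobenius norm, $\langle\cdot,\cdot\rangle$ the standard inner product, $[\cdot]^+$ the Euclidean projection onto $\mathbb{R}^m_+$. Problem: $\mathcal{N}$ is a finite set of agents. Agent $i\in\mathcal{N}$ has a decision variable $\bm{x}_i\in\mathbb{R}^{n_i}$, a local feasible region $\mathcal{X}_i\subset\mathbb{R}^{n_i}$ and a cost $f_i$. The aggregate decision is $\bm{x}=(\bm{x}_i)_{i\in\mathcal{N}}\in\mathbb{R}^n$, $\mathcal{X}=\prod_i\mathcal{X}_i$, $F(\bm{x})=\sum_if_i(\bm{x}_i)$; $A\in\mathbb{R}^{m\times n}$ has column blocks $A_i\in\mathbb{R}^{m\times n_i}$, so $A\bm{x}=\sum_iA_i\bm{x}_i$, and $\bm{b}\in\mathbb{R}^m$. The primal problem is: minimize $F(\bm{x})$ subject to $\bm{x}_i\in\mathcal{X}_i$ for all $i$ and $A\bm{x}\le\bm{b}$; its unique optimal solution is $\bm{x}^*$ and its optimal value is $F^*$. Assumption A1: (1) each $f_i$ is $c_i$-strongly convex ($c_i>0$) and twice differentiable over $\mathcal{X}_i$, and $c_F=\min_ic_i$; (2) each $\mathcal{X}_i$ is nonempty, compact and convex; (3) there exists a strictly feasible interior point in $\mathcal{X}$ such that $A\bm{x}\le\bm{b}$ holds. Dual: $\mathcal{L}_i(\bm{x}_i;\bm{\lambda})=f_i(\bm{x}_i)+\langle A_i^T\bm{\lambda},\bm{x}_i\rangle$, $\bm{x}_i(\bm{\lambda})=\arg\min_{\bm{x}_i\in\mathcal{X}_i}\mathcal{L}_i(\bm{x}_i;\bm{\lambda})$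 (unique), $D_i(\bm{\lambda})=\mathcal{L}_i(\bm{x}_i(\bm{\lambda});\bm{\lambda})$, $D(\bm{\lambda})=\sum_iD_i(\bm{\lambda})-\langle\bm{\lambda},\bm{b}\rangle$. The dual problem is to maximize $D$ over $\bm{\lambda}\ge0$; $\bm{\lambda}^*$ denotes an optimal dual solution, $D^*=D(\bm{\lambda}^* )$ the optimal value (equal to $F^*$ by strong duality), and $D^0:=D(\bm{\lambda}^0)$. Put $L_D=\|A\|_F^2/c_F$. Assumption A3 (inexactness): for every $\bm{\lambda}\in\mathbb{R}^m_+$ a solution $\widetilde{\bm{x}}_i(\bm{\lambda})\in\mathcal{X}_i$ is obtained, and there is $\varepsilon_i\ge0$ with $|\mathcal{L}_i(\bm{x}_i(\bm{\lambda});\bm{\lambda})-\mathcal{L}_i(\widetilde{\bm{x}}_i(\bm{\lambda});\bm{\lambda})|\le\varepsilon_i$ for all $\bm{\lambda}\in\mathbb{R}^m_+$. Put $\varepsilon_D=\sum_i\varepsilon_i$; the exact version of the algorithm is the case $\varepsilon_D=0$, i.e. $\widetilde{\bm{x}}_i(\bm{\lambda})=\bm{x}_i(\bm{\lambda})$. Algorithm: the global clock is $\mathcal{K}=\{0,1,2,\dots\}=\mathcal{K}_D\cup\bigcup_i\mathcal{K}_i$, where $\mathcal{K}_D$ (resp. $\mathcal{K}_i$) is the set of time slots at which the central coordinator (resp. agent $i$) takes action. Agents solve their subproblems using previously stored dual variables, and the coordinator uses previously stored primal solutions. Assumption A2 (asynchrony): there is an integer $k_0\ge0$ such that for every $k\in\mathcal{K}$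 the coordinator and all agents receive information (and act) at least once during $[k-k_0,k]$, so that $\mathcal{K}_D\cap[k-k_0,k]\neq\emptyset$ and $\mathcal{K}_i\cap[k-k_0,k]\ne\emptyset$ for every $k\ge0$ (in particular $0\in\mathcal{K}_D$); the delay on each side (coordinator to agent, agent to coordinator) is at most $k_0$. Consequently the primal information used by the coordinator at time $k$ is $\widehat{\bm{x}}^k=(\widehat{\bm{x}}^k_i)_i$ with $\widehat{\bm{x}}^k_i=\widetilde{\bm{x}}_i(\bm{\lambda}^{k-\delta_i^k})$ for some integer $0\le\delta_i^k\le2k_0$. Set $\bm{\nu}^k=A\widehat{\bm{x}}^k-\bm{b}$. Starting from $\bm{\lambda}^0\ge0$ with step size $\alpha$: if $k\in\mathcal{K}_D$, $\bm{\lambda}^{k+1}=[\bm{\lambda}^k+\alpha\bm{\nu}^k]^+$; otherwise $\bm{\lambda}^{k+1}=\bm{\lambda}^k$. The iteration is considered for all $k\ge0$ (no stopping test). Convention: $\bm{\lambda}^\kappa=\bm{\lambda}^0$ for $\kappa<0$. Averages: with $\mathcal{K}_D^k=\{\kappa\in\mathcal{K}_D:\kappa\le k\}$, $$\bar{\bm{x}}^k=\frac{1}{|\mathcal{K}_D^k|}\sum_{\kappa\in\mathcal{K}_D^k}\widehat{\bm{x}}^\kappa,\qquad\bar{\bm{\lambda}}^{k+1}=\frac{1}{|\mathcal{K}_D^k|}\sum_{\kappa\in\mathcal{K}_D^k}\bm{\lambda}^{\kappa+1}.$$ *)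

(* Defs.v *)
(* MathComp-Analysis, over an arbitrary [R : realType]. *)
From HB Require Import structures.
From mathcomp Require Import all_boot all_order all_algebra.
From mathcomp Require Import all_classical all_reals all_analysis.

Set Implicit Arguments.
Unset Strict Implicit.
Unset Printing Implicit Defensive.

Import Order.TTheory GRing.Theory Num.Theory.
Import numFieldNormedType.Exports.

Local Open Scope classical_set_scope.
Local Open Scope ring_scope.

(* The norm `|_| carried by matrices in the library is the sup norm; it only
   serves for the topology, and [enorm] is the norm of the results. *)
Definition dotv (R : realType) (d : nat) (u v : 'cV[R]_d) : R :=
  \sum_(j < d) u j 0 * v j 0.

Definition enorm (R : realType) (d : nat) (u : 'cV[R]_d) : R :=
  Num.sqrt (dotv u u).

Definition frobenius (R : realType) (p q : nat) (A : 'M[R]_(p, q)) : R :=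
  Num.sqrt (\sum_(i < p) \sum_(j < q) A i j ^+ 2).

Definition lev (R : realType) (d : nat) (u v : 'cV[R]_d) : Prop :=
  forall j, u j 0 <= v j 0.

Definition nonneg_orthant (R : realType) (d : nat) : set 'cV[R]_d :=
  [set u | lev 0 u].

Definition is_minimizer (R : realType) (T : Type) (S : set T) (phi : T -> R)
    (x : T) : Prop :=
  S x /\ forall y, S y -> phi x <= phi y.

Definition is_maximizer (R : realType) (T : Type) (S : set T) (phi : T -> R)
    (x : T) : Prop :=
  S x /\ forall y, S y -> phi y <= phi x.

(* Some minimizer of [phi] over [S], and 0 when there is none. *)
Definition argmin (R : realType) (d : nat) (S : set 'cV[R]_d)
    (phi : 'cV[R]_d -> R) : 'cV[R]_d :=
  xget 0 [set x | is_minimizer S phi x].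

Definition eproj (R : realType) (d : nat) (S : set 'cV[R]_d) (v : 'cV[R]_d) :
    'cV[R]_d :=
  argmin S (fun u => enorm (u - v)).

Definition pospart (R : realType) (d : nat) (v : 'cV[R]_d) : 'cV[R]_d :=
  eproj (@nonneg_orthant R d) v.

Definition strongly_convex_on (R : realType) (d : nat) (S : set 'cV[R]_d)
    (c : R) (f : 'cV[R]_d -> R) : Prop :=
  forall x y t, S x -> S y -> 0 <= t <= 1 ->
    f (t *: x + (1 - t) *: y)
      <= t * f x + (1 - t) * f y - c / 2 * t * (1 - t) * enorm (x - y) ^+ 2.

(* Only the values of [f] on [S] are involved, because [S] is typically closed
   and the differentiability is relative to it: [g] is the gradient and [H] the
   Hessian of [f] along [S]. A function that is twice differentiable on an open
   neighbourhood of [S] has this property. *)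
Definition twice_differentiable_on (R : realType) (d : nat) (S : set 'cV[R]_d)
    (f : 'cV[R]_d -> R) : Prop :=
  exists (g : 'cV[R]_d -> 'cV[R]_d) (H : 'cV[R]_d -> 'M[R]_d),
    forall x, S x ->
      ((fun y => f y - f x - dotv (g x) (y - x)) : 'cV[R]_d -> R^o)
        =o_ (within S (nbhs x)) (fun y => y - x) /\
      (fun y => g y - g x - H x *m (y - x))
        =o_ (within S (nbhs x)) (fun y => y - x).

(* There are N + 1 agents. A vector of R^n, n = \sum_i n i, is stacked from its
   blocks [submxcol x i], and the column blocks of A are [submxrow A i]. *)
Section DualDecomposition.
Context {R : realType} {N m : nat} {n : 'I_N.+1 -> nat}.
Implicit Types (X : forall i, set 'cV[R]_(n i))
  (f : forall i, 'cV[R]_(n i) -> R) (c eps : 'I_N.+1 -> R)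
  (A : 'M[R]_(m, \sum_i n i)) (b l : 'cV[R]_m)
  (xt : forall i, 'cV[R]_m -> 'cV[R]_(n i)).

Definition feasible_region X : set 'cV[R]_(\sum_i n i) :=
  [set x | forall i, X i (submxcol x i)].

Definition total_cost f (x : 'cV[R]_(\sum_i n i)) : R :=
  \sum_i f i (submxcol x i).

Definition primal_feasible X A b : set 'cV[R]_(\sum_i n i) :=
  [set x | feasible_region X x /\ lev (A *m x) b].

Definition lagrangian f A i (y : 'cV[R]_(n i)) l : R :=
  f i y + dotv ((submxrow A i)^T *m l) y.

Definition local_argmin X f A i l : 'cV[R]_(n i) :=
  argmin (X i) (fun y => lagrangian f A y l).

Definition local_dual X f A i l : R :=
  lagrangian f A (local_argmin X f A i l) l.

Definition dual X f A b l : R := \sum_i local_dual X f A i l - dotv l b.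

Definition c_F c : R := \big[Num.min/c ord0]_i c i.

Definition L_D c A : R := frobenius A ^+ 2 / c_F c.

Record problem_assumption X f c A b : Prop := {
  c_gt0 : forall i, 0 < c i ;
  cost_strongly_convex : forall i, strongly_convex_on (X i) (c i) (f i) ;
  cost_twice_differentiable : forall i, twice_differentiable_on (X i) (f i) ;
  region_nonempty : forall i, X i !=set0 ;
  region_compact : forall i, compact (X i) ;
  region_convex : forall i, convex_set (X i : set (convex_lmodType _)) ;
  region_interior : exists2 x, (feasible_region X)° x & lev (A *m x) b }.

(* [KD] and [Ka i] are the time slots at which the coordinator and agent [i]
   act. *)
Record asynchrony_assumption (k0 : nat) (KD : pred nat)
    (Ka : 'I_N.+1 -> pred nat) : Prop := {
  clock_cover : forall k, k \in KD \/ exists i, k \in Ka i ;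
  coordinator_acts : forall k,
    exists kappa, [/\ kappa \in KD, (kappa <= k)%N & (k <= kappa + k0)%N] ;
  agent_acts : forall i k,
    exists kappa, [/\ kappa \in Ka i, (kappa <= k)%N & (k <= kappa + k0)%N] }.

Record inexactness_assumption X f A xt eps : Prop := {
  eps_ge0 : forall i, 0 <= eps i ;
  inexact_in_region : forall i l, lev 0 l -> X i (xt i l) ;
  inexact_error : forall i l, lev 0 l ->
    `|lagrangian f A (local_argmin X f A i l) l - lagrangian f A (xt i l) l|
      <= eps i }.

(* [delta k i] is the delay of the dual variable behind the solution of agent
   [i] used at time [k]. Truncated subtraction on [nat] implements the
   convention that the dual iterate of a negative time is the initial one. *)
Definition delayed_primal xt (delta : nat -> 'I_N.+1 -> nat)
    (lam : nat -> 'cV[R]_m) (k : nat) : 'cV[R]_(\sum_i n i) :=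
  \mxcol_i xt i (lam (k - delta k i)%N).

Record dual_decomposition_run A b xt (k0 : nat) (KD : pred nat)
    (delta : nat -> 'I_N.+1 -> nat) (alpha : R) (lam : nat -> 'cV[R]_m) :
    Prop := {
  delay_bound : forall k i, (delta k i <= 2 * k0)%N ;
  initial_ge0 : lev 0 (lam 0) ;
  dual_update : forall k, lam k.+1 =
    if k \in KD
    then pospart (lam k + alpha *: (A *m delayed_primal xt delta lam k - b))
    else lam k }.

End DualDecomposition.

Definition active_slots (KD : pred nat) (k : nat) : seq nat :=
  [seq kappa <- iota 0 k.+1 | kappa \in KD].

Definition slot_average (R : realType) (d : nat) (KD : pred nat) (k : nat)
    (u : nat -> 'cV[R]_d) : 'cV[R]_d :=
  (size (active_slots KD k))%:R^-1 *: \sum_(kappa <- active_slots KD k) u kappa.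

(* Main.v *)
Require Import Defs.
From mathcomp Require Import all_boot all_order all_algebra.
From mathcomp Require Import all_classical all_reals all_analysis.
From mathcomp Require Import ring lra zify.

Set Implicit Arguments.
Unset Strict Implicit.
Unset Printing Implicit Defensive.

Import Order.TTheory GRing.Theory Num.Theory.
Import numFieldNormedType.Exports.

Local Open Scope classical_set_scope.
Local Open Scope ring_scope.

(** The dual function is a minimum of functions affine in the multiplier, and
    strong convexity of the costs makes it smooth. For agent [i], let [x l] be
    the minimizer of the Lagrangian at the multiplier [l]. Growing quadratically
    away from [x l], the Lagrangian satisfies two estimates with the modulus
    [frobenius (A_i) ^+ 2 / c i]: the map [l |-> A_i (x l)] is Lipschitz
    ([local_argmin_lipschitz]), and the excess of [x mu] at [l] is quadratic in
    [l - mu] ([local_gap]). The moduli of the agents add up to at most [L_D], so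
    each agent may use a multiplier of its own, which is how the delays are
    handled ([dual_ascent], [dual_gap]).

    Let [s k] be the length of the [k]-th step. A delay of at most [2 * k0]
    separates multipliers by at most the sum of the last [2 * k0] steps. In the
    ascent inequality for the projected gradient step this costs [s k] times
    that sum, and since a step belongs to at most [2 * k0] such sums, adding up
    over time gives
      [gamma * \sum_k s k ^+ 2 <= Dstar - D0]
    ([sum_step_sqr_le]).

    For a multiplier [z >= 0], the projection inequality and [dual_gap] bound
      [2 * alpha * (Lagrangian (xhat k) z - D (lam k.+1))]
    at an active slot by the decrease of [enorm (lam k - z) ^+ 2] plus a delay
    error controlled by squared steps; the sum over the slots telescopes and the
    total error is at most [8 * k0 * \sum_k s k ^+ 2] ([lagrangian_gap_sum]).
    Averages then turn these sums into rates, because at least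
    [(k + 1) / (k0 + 1)] slots up to time [k] are active: [z = 0] with weak
    duality and convexity of the cost bounds the primal value from above,
    [z = lamstar] with concavity of the dual bounds the dual value, and it also
    bounds [enorm (lam k.+1 - lamstar)]. As the projection only increases
    coordinates, [alpha] times the sum of the constraint residuals is at most
    [lam k.+1], whence the bound on the violation. Finally, [lamstar] and
    [xstar] form a saddle point ([strong_duality]), and the quadratic growth of
    the Lagrangian at [lamstar] around [xstar] gives the lower bound on the
    primal value and the distance to [xstar]. *)

(** * Euclidean geometry of column vectors *)

Section Euclidean.
Context {R : realType} {d : nat}.
Implicit Types (u v w : 'cV[R]_d) (a : R).

Lemma dotvE u v : dotv u v = (u^T *m v) 0 0.
Proof. by rewrite mxE; apply: eq_bigr => j _; rewrite !mxE. Qed.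

Lemma dotvC u v : dotv u v = dotv v u.
Proof. by apply: eq_bigr => j _; rewrite mulrC. Qed.

Lemma dotvDr u v w : dotv u (v + w) = dotv u v + dotv u w.
Proof. by rewrite !dotvE mulmxDr mxE. Qed.

Lemma dotvZr a u v : dotv u (a *: v) = a * dotv u v.
Proof. by rewrite !dotvE -scalemxAr mxE. Qed.

Lemma dotvNr u v : dotv u (- v) = - dotv u v.
Proof. by rewrite -scaleN1r dotvZr mulN1r. Qed.

Lemma dotvBr u v w : dotv u (v - w) = dotv u v - dotv u w.
Proof. by rewrite dotvDr dotvNr. Qed.

Lemma dotvDl u v w : dotv (u + v) w = dotv u w + dotv v w.
Proof. by rewrite dotvC dotvDr !(dotvC w). Qed.

Lemma dotvZl a u v : dotv (a *: u) v = a * dotv u v.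
Proof. by rewrite dotvC dotvZr dotvC. Qed.

Lemma dotvNl u v : dotv (- u) v = - dotv u v.
Proof. by rewrite dotvC dotvNr dotvC. Qed.

Lemma dotvBl u v w : dotv (u - v) w = dotv u w - dotv v w.
Proof. by rewrite dotvDl dotvNl. Qed.

Lemma dotv0l u : dotv 0 u = 0.
Proof. by rewrite -(scale0r 0) dotvZl mul0r. Qed.

Lemma dotv0r u : dotv u 0 = 0.
Proof. by rewrite dotvC dotv0l. Qed.

Lemma dotv_sumr (I : Type) (r : seq I) u (F : I -> 'cV[R]_d) :
  dotv u (\sum_(i <- r) F i) = \sum_(i <- r) dotv u (F i).
Proof.
elim/big_rec2: _ => [|i y1 y2 _ <-]; first by rewrite dotv0r.
by rewrite dotvDr.
Qed.

Lemma dotv_ge0 u v : lev 0 u -> lev 0 v -> 0 <= dotv u v.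
Proof.
move=> u0 v0; apply: sumr_ge0 => j _.
by move: (u0 j) (v0 j); rewrite mxE => ? ?; rewrite mulr_ge0.
Qed.

Lemma dotvv_ge0 u : 0 <= dotv u u.
Proof. by apply: sumr_ge0 => j _; rewrite -expr2 sqr_ge0. Qed.

Lemma dotvv_eq0 u : dotv u u = 0 -> u = 0.
Proof.
move=> /eqP; rewrite psumr_eq0 => [/allP u0|j _]; last by rewrite -expr2 sqr_ge0.
apply/colP => j; rewrite mxE; apply/eqP.
by have := u0 j (mem_index_enum _); rewrite -expr2 sqrf_eq0.
Qed.

Lemma enorm_ge0 u : 0 <= enorm u. Proof. exact: sqrtr_ge0. Qed.

Lemma enorm_sqr u : enorm u ^+ 2 = dotv u u.
Proof. by rewrite sqr_sqrtr // dotvv_ge0. Qed.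

Lemma enorm0 : enorm (0 : 'cV[R]_d) = 0.
Proof. by rewrite /enorm dotv0l sqrtr0. Qed.

Lemma enorm_eq0 u : enorm u = 0 -> u = 0.
Proof. by move=> u0; apply: dotvv_eq0; rewrite -enorm_sqr u0 expr0n. Qed.

Lemma enormN u : enorm (- u) = enorm u.
Proof. by rewrite /enorm dotvNl dotvNr opprK. Qed.

Lemma enormBC u v : enorm (u - v) = enorm (v - u).
Proof. by rewrite -opprB enormN. Qed.

Lemma enormZ a u : 0 <= a -> enorm (a *: u) = a * enorm u.
Proof.
move=> a0; rewrite /enorm dotvZl dotvZr mulrA sqrtrM ?mulr_ge0 //.
by rewrite -expr2 sqrtr_sqr ger0_norm.
Qed.

Lemma enormB_sqr u v :
  enorm (u - v) ^+ 2 = enorm u ^+ 2 - 2 * dotv u v + enorm v ^+ 2.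
Proof. by rewrite !enorm_sqr dotvBl !dotvBr (dotvC v u); ring. Qed.

Lemma enorm_le_sqr u a : 0 <= a -> enorm u ^+ 2 <= a ^+ 2 -> enorm u <= a.
Proof. by move=> a0; rewrite ler_sqr ?nnegrE ?enorm_ge0. Qed.

Lemma dotv_le_enorm u v : dotv u v <= enorm u * enorm v.
Proof.
have [v0|v0] := eqVneq (enorm v) 0.
  by rewrite v0 mulr0 (enorm_eq0 v0) dotv0r.
have vp : 0 < enorm v by rewrite lt_neqAle eq_sym v0 enorm_ge0.
(* [t] makes [u - t *: v] orthogonal to [v]. *)
pose t := dotv u v / enorm v ^+ 2.
have := sqr_ge0 (enorm (u - t *: v)).
rewrite enormB_sqr dotvZr !enorm_sqr dotvZl dotvZr -!enorm_sqr.
have -> : enorm u ^+ 2 - 2 * (t * dotv u v) + t * (t * enorm v ^+ 2) =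
    enorm u ^+ 2 - (dotv u v / enorm v) ^+ 2 by rewrite /t; field.
rewrite subr_ge0 => h.
have : `|dotv u v / enorm v| <= `|enorm u|.
  by rewrite -ler_sqr ?nnegrE // !real_normK ?num_real.
rewrite (ger0_norm (enorm_ge0 u)) => /(le_trans (ler_norm _)).
by rewrite ler_pdivrMr.
Qed.

Lemma dotv_ge_enorm u v : - (enorm u * enorm v) <= dotv u v.
Proof. by have := dotv_le_enorm (- u) v; rewrite enormN dotvNl; lra. Qed.

Lemma ler_enormD u v : enorm (u + v) <= enorm u + enorm v.
Proof.
apply: enorm_le_sqr; first by rewrite addr_ge0 ?enorm_ge0.
have := enormB_sqr u (- v); rewrite opprK enormN dotvNr => ->.
by have := dotv_le_enorm u v; nra.
Qed.

Lemma ler_enorm_lev u v : lev 0 u -> lev u v -> enorm u <= enorm v.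
Proof.
move=> u0 uv; apply: ler_wsqrtr; apply: ler_sum => j _.
by move: (u0 j) (uv j); rewrite mxE; nra.
Qed.

End Euclidean.

Lemma dotv_trmx (R : realType) p q (A : 'M[R]_(p, q)) l y :
  dotv (A^T *m l) y = dotv l (A *m y).
Proof. by rewrite !dotvE trmx_mul trmxK mulmxA. Qed.

Lemma frobenius_ge0 (R : realType) p q (A : 'M[R]_(p, q)) : 0 <= frobenius A.
Proof. exact: sqrtr_ge0. Qed.

Lemma frobenius_sqr (R : realType) p q (A : 'M[R]_(p, q)) :
  frobenius A ^+ 2 = \tr (A *m A^T).
Proof.
rewrite sqr_sqrtr; last first.
  by apply: sumr_ge0 => i _; apply: sumr_ge0 => j _; rewrite sqr_ge0.
apply: eq_bigr => i _; rewrite mxE.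
by apply: eq_bigr => j _; rewrite !mxE expr2.
Qed.

Lemma enorm_mulmx_le (R : realType) p q (A : 'M[R]_(p, q)) y :
  enorm (A *m y) <= frobenius A * enorm y.
Proof.
apply: enorm_le_sqr; first by rewrite mulr_ge0 ?frobenius_ge0 ?enorm_ge0.
rewrite exprMn frobenius_sqr /mxtrace enorm_sqr mulr_suml.
apply: ler_sum => i _.
have rowE (v : 'cV[R]_q) : (A *m v) i 0 = dotv (row i A)^T v.
  by rewrite dotvE trmxK -row_mul !mxE.
have -> : (A *m A^T) i i = enorm (row i A)^T ^+ 2.
  by rewrite enorm_sqr dotvE trmxK !mxE; apply: eq_bigr => j _; rewrite !mxE.
rewrite -expr2 rowE -exprMn -real_normK ?num_real //.
rewrite ler_sqr ?nnegrE ?mulr_ge0 ?enorm_ge0 // ler_norml.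
by rewrite dotv_le_enorm dotv_ge_enorm.
Qed.

Lemma dotv_mulmx_ge (R : realType) p q (A : 'M[R]_(p, q)) l y :
  - (enorm l * frobenius A * enorm y) <= dotv l (A *m y).
Proof.
have := dotv_ge_enorm l (A *m y).
by have := enorm_mulmx_le A y; have := enorm_ge0 l; nra.
Qed.

(** * Minimizers of strongly convex functions *)

Section Argmin.
Context {R : realType} {d : nat}.
Implicit Types (S : set 'cV[R]_d) (phi f : 'cV[R]_d -> R) (x y : 'cV[R]_d).

Lemma argmin_minimizer S phi :
  (exists x, is_minimizer S phi x) -> is_minimizer S phi (argmin S phi).
Proof. exact: xgetPex. Qed.

Lemma convex_setP S x y (t : R) :
  convex_set (S : set (convex_lmodType _)) -> S x -> S y -> 0 <= t <= 1 ->
  S (t *: x + (1 - t) *: y).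
Proof.
move=> cS Sx Sy /andP[t0 t1].
have ti : Itv.spec (@Itv.num_sem R) (Itv.Real `[0%Z, 1%Z]) t.
  by rewrite /= /Itv.num_sem /= num_real /= in_itv /= t0 t1.
have := cS x y (Itv.mk ti); by rewrite !inE => /(_ Sx Sy).
Qed.

(** Comparing [x] with [t *: y + (1 - t) *: x] and letting [t] tend to 0 keeps
    the whole quadratic term of strong convexity. *)
Lemma quadratic_growth S (c : R) phi x y :
  convex_set (S : set (convex_lmodType _)) -> strongly_convex_on S c phi ->
  0 < c -> is_minimizer S phi x -> S y ->
  phi x + c / 2 * enorm (y - x) ^+ 2 <= phi y.
Proof.
move=> cS sc c0 [Sx minx] Sy.
have g0 : phi x <= phi y := minx y Sy.
rewrite leNgt; apply/negP => lt.
set K := c / 2 * enorm (y - x) ^+ 2 in lt.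
have K0 : 0 < K by lra.
(* With this [t], [(1 - t) * K] is halfway between [phi y - phi x] and [K]. *)
pose t := (K - (phi y - phi x)) / (2 * K).
have tK : t * K = (K - (phi y - phi x)) / 2 by rewrite /t; field; lra.
have t0 : 0 < t by rewrite /t divr_gt0 //; lra.
have t1 : t <= 1 by rewrite /t ler_pdivrMr; lra.
have t01 : 0 <= t <= 1 by rewrite (ltW t0).
have := le_trans (minx _ (convex_setP cS Sy Sx t01)) (sc y x t Sy Sx t01).
have -> : c / 2 * t * (1 - t) * enorm (y - x) ^+ 2 = t * (K - t * K).
  by rewrite /K; ring.
rewrite tK => h.
have : 0 <= t * (phi y - phi x - (K + (phi y - phi x)) / 2) by lra.
by rewrite pmulr_rge0 //; lra.
Qed.

Lemma minimizer_unique S (c : R) phi x y :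
  convex_set (S : set (convex_lmodType _)) -> strongly_convex_on S c phi ->
  0 < c -> is_minimizer S phi x -> S y -> phi y <= phi x -> y = x.
Proof.
move=> cS sc c0 minx Sy yx.
have := quadratic_growth cS sc c0 minx Sy => h.
apply/eqP; rewrite -subr_eq0; apply/eqP; apply: dotvv_eq0; rewrite -enorm_sqr.
by apply/eqP; rewrite eq_le sqr_ge0 andbT; have := sqr_ge0 (enorm (y - x)); nra.
Qed.

Lemma strongly_convex_addl S (c : R) f (g : 'cV[R]_d) :
  strongly_convex_on S c f ->
  strongly_convex_on S c (fun y => f y + dotv g y).
Proof.
move=> sc x y t Sx Sy t01; have := sc x y t Sx Sy t01.
by rewrite dotvDr !dotvZr; lra.
Qed.

Lemma strongly_convex_jensen S (c : R) f : 0 <= c ->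
  convex_set (S : set (convex_lmodType _)) -> strongly_convex_on S c f ->
  forall (I : Type) (r : seq I) (u : I -> 'cV[R]_d),
  (0 < size r)%N -> (forall i, S (u i)) ->
  let avg := (size r)%:R^-1 *: \sum_(i <- r) u i in
  S avg /\ f avg <= (size r)%:R^-1 * \sum_(i <- r) f (u i).
Proof.
move=> c0 cS sc I r u + Su; elim: r => [//|i r IH] _.
have [r0|rp] := posnP (size r).
  case: r r0 {IH} => // _.
  by rewrite !big_cons !big_nil /= invr1 scale1r mul1r !addr0.
have [Savg favg] := IH rp; rewrite !big_cons /=.
set a := _ *: _ in Savg favg; set p : R := (size r)%:R in a Savg favg *.
have p0 : 0 < p by rewrite ltr0n.
(* The new average puts weight [t] on the new point. *)
pose t : R := (1 + p)^-1.
have t01 : 0 <= t <= 1.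
  by rewrite /t invr_ge0 invf_le1; [apply/andP; split; lra|lra].
have -> : (size r).+1%:R = 1 + p :> R by rewrite -natr1 addrC.
have tp : (1 - t) * p^-1 = t by rewrite /t; field; lra.
have -> : (1 + p)^-1 *: (u i + \sum_(j <- r) u j) = t *: u i + (1 - t) *: a.
  by rewrite /a scalerA tp -scalerDr.
split; first exact: convex_setP.
apply: le_trans (sc _ _ _ (Su i) Savg t01) _.
have -> : (1 + p)^-1 * (f (u i) + \sum_(j <- r) f (u j)) =
    t * f (u i) + (1 - t) * (p^-1 * \sum_(j <- r) f (u j)).
  by rewrite mulrA tp -mulrDr.
case/andP: t01 => t0 t1.
have : 0 <= c / 2 * t * (1 - t) * enorm (u i - a) ^+ 2.
  by apply: mulr_ge0 (sqr_ge0 _); rewrite !mulr_ge0 ?subr_ge0 //; lra.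
have : (1 - t) * f a <= (1 - t) * (p^-1 * \sum_(j <- r) f (u j)).
  by rewrite ler_wpM2l //; lra.
lra.
Qed.

End Argmin.

Section ExistenceMinimizer.
Context {R : realType} {d : nat}.
Implicit Types (S : set 'cV[R]_d) (f : 'cV[R]_d -> R).

Lemma normr_dotv_le (g u : 'cV[R]_d) :
  `|dotv g u| <= (\sum_j `|g j 0|) * `|u|.
Proof.
rewrite mulr_suml; apply: le_trans (ler_norm_sum _ _ _) _.
apply: ler_sum => j _; rewrite normrM ler_wpM2l //.
by rewrite [leRHS]/Num.Def.normr /= mx_normrE (le_bigmax _ _ (j, 0)).
Qed.

(** Near [x], the first-order expansion bounds [f y - f x] by a multiple of
    the norm of [y - x]. *)
Lemma twice_differentiable_continuous S f :
  twice_differentiable_on S f -> {within S, continuous f}.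
Proof.
move=> [g [H dfH]]; apply/subspace_continuousP => x Sx.
have [/eqoP df _] := dfH x Sx.
apply/cvgrPdist_le => /= e e0.
pose K : R := \sum_j `|g x j 0|.
have K0 : 0 <= K by apply: sumr_ge0.
have xS : \forall y \near within S (nbhs x), `|y - x| <= e / (1 + K).
  suff : \forall y \near x, `|y - x| <= e / (1 + K).
    by move=> h; apply: filterS h => y h _.
  apply/nbhs_normP; exists (e / (1 + K)) => /=; first by rewrite divr_gt0 //; lra.
  by move=> y /=; rewrite distrC => /ltW.
near=> y.
have h1 : `|f y - f x - dotv (g x) (y - x)| <= 1 * `|y - x|.
  by near: y; apply: df.
have h2 := normr_dotv_le (g x) (y - x).
have h3 : `|y - x| <= e / (1 + K) by near: y.
have h4 : (1 + K) * `|y - x| <= e by rewrite mulrC -ler_pdivlMr //; lra.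
rewrite distrC.
have -> : f y - f x = (f y - f x - dotv (g x) (y - x)) + dotv (g x) (y - x).
  by rewrite subrK.
apply: le_trans (ler_normD _ _) _; rewrite -/K in h2; lra.
Unshelve. all: by end_near.
Qed.

Lemma argmin_lagrangian_minimizer S f (g : 'cV[R]_d) :
  S !=set0 -> compact S -> twice_differentiable_on S f ->
  is_minimizer S (fun y => f y + dotv g y) (argmin S (fun y => f y + dotv g y)).
Proof.
move=> S0 cS [df [H dfH]]; apply: argmin_minimizer.
(* A linear term only shifts the gradient. *)
have : twice_differentiable_on S (fun y => f y + dotv g y).
  exists (fun x => df x + g), H => x Sx; have [h1 h2] := dfH x Sx.
  split; apply/eqoP => e e0.
    move/eqoP/(_ e e0): h1; apply: filterS => y.
    suff -> : f y + dotv g y - (f x + dotv g x) - dotv (df x + g) (y - x) =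
      f y - f x - dotv (df x) (y - x) by [].
    by rewrite dotvDl (dotvBr g); ring.
  move/eqoP/(_ e e0): h2; apply: filterS => y.
  suff -> : df y + g - (df x + g) - H x *m (y - x) =
    df y - df x - H x *m (y - x) by [].
  by rewrite opprD addrACA subrr addr0.
move=> /twice_differentiable_continuous cf.
have [x Sx minx] := compact_EVT_min S0 cS cf.
exists x; split; first by rewrite inE in Sx.
by move=> y Sy; apply: minx; rewrite inE.
Qed.

End ExistenceMinimizer.

(** * Projection onto the nonnegative orthant *)

Section PositivePart.
Context {R : realType} {d : nat}.
Implicit Types u v w z : 'cV[R]_d.

Let maxv v : 'cV[R]_d := \col_j Num.max 0 (v j 0).

Let maxv_ge0 v : lev 0 (maxv v).
Proof. by move=> j; rewrite !mxE le_max lexx. Qed.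

Let maxv_obtuse v z : lev 0 z -> dotv (v - maxv v) (z - maxv v) <= 0.
Proof.
move=> z0; apply: sumr_le0 => j _; move: (z0 j); rewrite !mxE => zj.
by case: (leP 0 (v j 0)) => vj; nra.
Qed.

(** The obtuse angle at the coordinatewise positive part makes it the only
    minimizer of the distance to [v] over the orthant. *)
Lemma pospartE v : pospart v = \col_j Num.max 0 (v j 0).
Proof.
rewrite -/(maxv v) /pospart /eproj.
have expand z : enorm (z - v) ^+ 2 =
    enorm (maxv v - v) ^+ 2 + enorm (z - maxv v) ^+ 2
    - 2 * dotv (v - maxv v) (z - maxv v).
  by rewrite !enorm_sqr !(dotvBl, dotvBr) (dotvC (maxv v) z) (dotvC v z)
             (dotvC v (maxv v)); ring.
have [z0 minz] : is_minimizer (@nonneg_orthant R d) (fun u => enorm (u - v))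
    (argmin (@nonneg_orthant R d) (fun u => enorm (u - v))).
  apply: argmin_minimizer.
  exists (maxv v); split => [|z z0]; first exact: maxv_ge0.
  rewrite -ler_sqr ?nnegrE ?enorm_ge0 // (expand z).
  by have := maxv_obtuse v z0; have := sqr_ge0 (enorm (z - maxv v)); lra.
set z := argmin _ _ in z0 minz *.
have := minz _ (maxv_ge0 v).
rewrite -ler_sqr ?nnegrE ?enorm_ge0 // (expand z) => h.
apply/eqP; rewrite -subr_eq0; apply/eqP; apply: dotvv_eq0; rewrite -enorm_sqr.
apply/eqP; rewrite eq_le sqr_ge0 andbT.
by have := maxv_obtuse v z0; lra.
Qed.

Lemma pospart_ge0 v : lev 0 (pospart v).
Proof. by rewrite pospartE; apply: maxv_ge0. Qed.

Lemma lev_pospart v : lev v (pospart v).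
Proof. by move=> j; rewrite pospartE mxE le_max lexx orbT. Qed.

Lemma pospart_obtuse v z :
  lev 0 z -> dotv (v - pospart v) (z - pospart v) <= 0.
Proof. by rewrite pospartE; apply: maxv_obtuse. Qed.

Lemma enorm_pospart_le v w :
  lev 0 w -> lev v w -> enorm (pospart v) <= enorm w.
Proof.
move=> w0 vw; apply: ler_enorm_lev; first exact: pospart_ge0.
move=> j; rewrite pospartE mxE ge_max vw andbT.
by have := w0 j; rewrite mxE.
Qed.

End PositivePart.
(** * The dual function of a separable problem *)

Section Blocks.
Context {R : realType} {N m : nat} {n : 'I_N.+1 -> nat}.
Implicit Types (A : 'M[R]_(m, \sum_i n i)) (x y : 'cV[R]_(\sum_i n i)).

Lemma mulmx_blocks A x : A *m x = \sum_i submxrow A i *m submxcol x i.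
Proof. by rewrite -[in LHS](submxrowK A) -[in LHS](submxcolK x) mul_mxrow_mxcol. Qed.

Lemma frobenius_blocks A :
  frobenius A ^+ 2 = \sum_i frobenius (submxrow A i) ^+ 2.
Proof.
rewrite frobenius_sqr -[in LHS](submxrowK A) tr_mxrow mul_mxrow_mxcol raddf_sum /=.
by apply: eq_bigr => i _; rewrite frobenius_sqr.
Qed.

Lemma enorm_blocks x : enorm x ^+ 2 = \sum_i enorm (submxcol x i) ^+ 2.
Proof.
rewrite enorm_sqr dotvE -[in LHS](submxcolK x) tr_mxcol mul_mxrow_mxcol summxE.
by apply: eq_bigr => i _; rewrite enorm_sqr dotvE.
Qed.

Lemma submxcolZ (a : R) x i : submxcol (a *: x) i = a *: submxcol x i.
Proof. by apply/colP => j; rewrite !mxE. Qed.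

Lemma submxcol_sums (I : Type) (r : seq I) (u : I -> 'cV[R]_(\sum_i n i)) i :
  submxcol (\sum_(k <- r) u k) i = \sum_(k <- r) submxcol (u k) i.
Proof.
by apply/colP => j; rewrite mxE !summxE; apply: eq_bigr => k _; rewrite mxE.
Qed.

End Blocks.

Section DualFunction.
Context {R : realType} {N m : nat} {n : 'I_N.+1 -> nat}.
Unset Implicit Arguments.
Context (X : forall i, set 'cV[R]_(n i)) (f : forall i, 'cV[R]_(n i) -> R).
Set Implicit Arguments.
Context (c : 'I_N.+1 -> R) (A : 'M[R]_(m, \sum_i n i)) (b : 'cV[R]_m).
Context (pb : problem_assumption X f c A b).
Implicit Types (l mu z : 'cV[R]_m) (x : 'cV[R]_(\sum_i n i)).

Local Notation D := (dual X f A b).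
Local Notation Ai i := (submxrow A i).
Local Notation xl := (local_argmin X f A).

Definition full_lagrangian x l : R := total_cost f x + dotv l (A *m x - b).

Definition primal_response (mu : 'I_N.+1 -> 'cV[R]_m) : 'cV[R]_(\sum_i n i) :=
  \mxcol_i xl i (mu i).

Lemma local_argmin_minimizer i l :
  is_minimizer (X i) (fun y => lagrangian f A y l) (xl i l).
Proof.
apply: argmin_lagrangian_minimizer; first exact: region_nonempty pb i.
  exact: region_compact pb i.
exact: cost_twice_differentiable pb i.
Qed.

Lemma lagrangian_shift i (y : 'cV[R]_(n i)) l mu :
  lagrangian f A y l = lagrangian f A y mu + dotv (l - mu) (Ai i *m y).
Proof. by rewrite /lagrangian !dotv_trmx dotvBl; ring. Qed.

Lemma lagrangian_strongly_convex i l :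
  strongly_convex_on (X i) (c i) (fun y => lagrangian f A y l).
Proof.
have sc := @cost_strongly_convex _ _ _ _ _ _ _ _ _ pb i.
exact: strongly_convex_addl ((Ai i)^T *m l) sc.
Qed.

Lemma local_dual_growth i (y : 'cV[R]_(n i)) l : X i y ->
  local_dual X f A i l + c i / 2 * enorm (y - xl i l) ^+ 2
    <= lagrangian f A y l.
Proof.
apply: (@quadratic_growth _ _ (X i) (c i) (fun y => lagrangian f A y l)).
- exact: region_convex pb i.
- exact: lagrangian_strongly_convex.
- exact: c_gt0 pb i.
- exact: local_argmin_minimizer.
Qed.

Lemma local_dual_le i (y : 'cV[R]_(n i)) l :
  X i y -> local_dual X f A i l <= lagrangian f A y l.
Proof. by move=> Xy; apply: (local_argmin_minimizer i l).2. Qed.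

(** Nonnegative errors with sum 0 vanish, and then the uniqueness of the
    minimizer turns equal values into equal points. *)
Lemma inexact_exactE xt eps i l :
  inexactness_assumption X f A xt eps -> \sum_i eps i = 0 -> lev 0 l ->
  xt i l = xl i l.
Proof.
move=> inx /eqP; rewrite psumr_eq0 => [/allP e0 l0|j _]; last exact: eps_ge0 inx j.
have /eqP ei : eps i == 0 by apply: e0; rewrite mem_index_enum.
have := inexact_error inx i l0; rewrite ei normr_le0 subr_eq0 => /eqP Lxt.
apply: (@minimizer_unique _ _ (X i) (c i) (fun y => lagrangian f A y l)).
- exact: region_convex pb i.
- exact: lagrangian_strongly_convex.
- exact: c_gt0 pb i.
- exact: local_argmin_minimizer.
- exact: inexact_in_region inx i l l0.
- by rewrite Lxt.
Qed.

(** Adding the quadratic growth at the minimizers for [l] and for [mu] cancels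
    the costs and leaves only the difference of the linear terms. *)
Lemma local_argmin_lipschitz i l mu :
  c i * enorm (xl i l - xl i mu) <= frobenius (Ai i) * enorm (l - mu).
Proof.
have [Xl _] := local_argmin_minimizer i l.
have [Xmu _] := local_argmin_minimizer i mu.
have h1 := local_dual_growth l Xmu; have h2 := local_dual_growth mu Xl.
have e0 := enorm_ge0 (xl i l - xl i mu).
rewrite enormBC in h1; set e := enorm (xl i l - xl i mu) in h1 h2 e0 *.
rewrite (lagrangian_shift _ l mu) in h1.
rewrite (lagrangian_shift _ mu l) in h2.
have := dotv_mulmx_ge (Ai i) (l - mu) (xl i l - xl i mu).
rewrite -/e mulmxBr dotvBr.
rewrite -(opprB l mu) dotvNl in h2; rewrite /local_dual in h1 h2 => h3.
have h4 : e * (c i * e) <= e * (frobenius (Ai i) * enorm (l - mu)).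
  by move: h1 h2 h3; rewrite expr2; lra.
have [ez|ep] := eqVneq e 0.
  by rewrite ez mulr0 mulr_ge0 ?frobenius_ge0 ?enorm_ge0.
by rewrite ler_pM2l // in h4; rewrite lt_neqAle eq_sym ep.
Qed.

Definition local_modulus i : R := frobenius (Ai i) ^+ 2 / c i.

Lemma local_modulus_ge0 i : 0 <= local_modulus i.
Proof. by rewrite divr_ge0 ?sqr_ge0 // ltW // (c_gt0 pb). Qed.

(** The response to [mu] is nearly optimal for [l]: its excess is at most
    [a * e - c / 2 * e ^+ 2], where [e] is the distance to the response to [l]
    and [a] is [frobenius (Ai i) * enorm (l - mu)]. *)
Lemma local_gap i l mu :
  lagrangian f A (xl i mu) l
    <= local_dual X f A i l + local_modulus i / 2 * enorm (l - mu) ^+ 2.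
Proof.
have ci := c_gt0 pb i.
have [Xl _] := local_argmin_minimizer i l.
have h1 := local_dual_growth mu Xl; rewrite enormBC in h1.
have := dotv_mulmx_ge (Ai i) (l - mu) (xl i l - xl i mu).
rewrite (enormBC (xl i l)) mulmxBr dotvBr => h3.
rewrite /local_dual in h1 *; rewrite (lagrangian_shift (xl i mu) l mu).
rewrite (lagrangian_shift (xl i l) l mu).
set e := enorm (xl i mu - xl i l) in h1 h3.
set a := frobenius (Ai i) * enorm (l - mu).
have -> : local_modulus i / 2 * enorm (l - mu) ^+ 2 =
    a * e - c i / 2 * e ^+ 2 + (a - c i * e) ^+ 2 / (2 * c i).
  by rewrite /local_modulus /a; field; lra.
have : 0 <= (a - c i * e) ^+ 2 / (2 * c i).
  by rewrite divr_ge0 ?sqr_ge0 //; lra.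
have : enorm (l - mu) * frobenius (Ai i) * e = a * e by rewrite /a; ring.
lra.
Qed.

Lemma local_ascent i l l' mu :
  local_dual X f A i l + dotv (l' - l) (Ai i *m xl i mu)
    - local_modulus i
      * (enorm (l' - l) ^+ 2 / 2 + enorm (l' - l) * enorm (l - mu))
  <= local_dual X f A i l'.
Proof.
have ci := c_gt0 pb i.
have h1 := local_gap i l' l; rewrite (lagrangian_shift (xl i l) l' l) in h1.
have := dotv_mulmx_ge (Ai i) (l' - l) (xl i l - xl i mu).
rewrite mulmxBr dotvBr => h2.
have h3 : enorm (xl i l - xl i mu) <= frobenius (Ai i) * enorm (l - mu) / c i.
  by rewrite ler_pdivlMr // mulrC local_argmin_lipschitz.
have h4 : enorm (l' - l) * frobenius (Ai i) * enorm (xl i l - xl i mu) <=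
    local_modulus i * (enorm (l' - l) * enorm (l - mu)).
  apply: le_trans (ler_wpM2l _ h3) _.
    by rewrite mulr_ge0 ?frobenius_ge0 ?enorm_ge0.
  by rewrite /local_modulus le_eqVlt; apply/orP; left; apply/eqP; field; lra.
by move: h1; rewrite /local_dual; lra.
Qed.

Lemma c_F_le i : c_F c <= c i. Proof. exact: bigmin_le. Qed.

Lemma c_F_gt0 : 0 < c_F c.
Proof. by apply: lt_bigmin => [|i _]; apply: c_gt0 pb _. Qed.

Lemma L_D_ge0 : 0 <= L_D c A.
Proof. by rewrite divr_ge0 ?sqr_ge0 // ltW // c_F_gt0. Qed.

Lemma sum_local_modulus_le : \sum_i local_modulus i <= L_D c A.
Proof.
rewrite /L_D frobenius_blocks mulr_suml; apply: ler_sum => i _.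
by rewrite ler_wpM2l ?sqr_ge0 // lef_pV2 ?posrE ?c_F_gt0 ?c_F_le ?(c_gt0 pb).
Qed.

Lemma full_lagrangianE x l :
  full_lagrangian x l = \sum_i lagrangian f A (submxcol x i) l - dotv l b.
Proof.
rewrite big_split /= /full_lagrangian dotvBr mulmx_blocks dotv_sumr addrA.
by congr (_ + _ - _); apply: eq_bigr => i _; rewrite dotv_trmx.
Qed.

Lemma full_lagrangian_shift x l z :
  full_lagrangian x l = full_lagrangian x z + dotv (l - z) (A *m x - b).
Proof. by rewrite /full_lagrangian dotvBl; ring. Qed.

Lemma full_lagrangian0 x : full_lagrangian x 0 = total_cost f x.
Proof. by rewrite /full_lagrangian dotv0l addr0. Qed.

Lemma primal_response_feasible (mu : 'I_N.+1 -> 'cV[R]_m) :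
  feasible_region X (primal_response mu).
Proof. by move=> i; rewrite mxcolK; case: (local_argmin_minimizer i (mu i)). Qed.

Lemma dualE l : D l = full_lagrangian (primal_response (fun=> l)) l.
Proof.
rewrite full_lagrangianE; congr (_ - _); apply: eq_bigr => i _.
by rewrite mxcolK.
Qed.

Lemma dual_le x l : feasible_region X x -> D l <= full_lagrangian x l.
Proof.
move=> Xx; rewrite full_lagrangianE lerD2r; apply: ler_sum => i _.
exact: local_dual_le.
Qed.

Lemma dual_growth x l : feasible_region X x ->
  D l + c_F c / 2 * enorm (x - primal_response (fun=> l)) ^+ 2
    <= full_lagrangian x l.
Proof.
move=> Xx; rewrite full_lagrangianE enorm_blocks mulr_sumr addrAC lerD2r.
rewrite -big_split /=; apply: ler_sum => i _.
apply: le_trans (local_dual_growth l (Xx i)); rewrite lerD2l submxcolB mxcolK.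
by rewrite ler_wpM2r ?sqr_ge0 // ler_wpM2r ?invr_ge0 // c_F_le.
Qed.

Lemma lagrangian_le_cost x l :
  primal_feasible X A b x -> lev 0 l -> full_lagrangian x l <= total_cost f x.
Proof.
move=> [_ Axb] l0; rewrite /full_lagrangian gerDl -oppr_ge0 -dotvNr.
by apply: dotv_ge0 => // j; have := Axb j; rewrite !mxE; lra.
Qed.

Lemma weak_duality x l :
  primal_feasible X A b x -> lev 0 l -> D l <= total_cost f x.
Proof.
by move=> xf l0; apply: le_trans (dual_le l xf.1) (lagrangian_le_cost xf l0).
Qed.

(** Stale information enters the gradient inequality of the dual only through
    the distance [w] between the current and the delayed multipliers. *)
Lemma dual_ascent l l' (mu : 'I_N.+1 -> 'cV[R]_m) (w : R) :
  (forall i, enorm (l - mu i) <= w) ->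
  D l + dotv (l' - l) (A *m primal_response mu - b)
    - L_D c A * (enorm (l' - l) ^+ 2 / 2 + enorm (l' - l) * w)
  <= D l'.
Proof.
move=> hw; set s := enorm (l' - l); set B := s ^+ 2 / 2 + s * w.
have s0 : 0 <= s := enorm_ge0 _.
have w0 : 0 <= w := le_trans (enorm_ge0 _) (hw ord0).
have B0 : 0 <= B by rewrite addr_ge0 ?mulr_ge0 ?sqr_ge0.
rewrite dotvBr mulmx_blocks dotv_sumr (dotvBl l' l b) /dual.
have h : \sum_i (local_dual X f A i l
      + dotv (l' - l) (Ai i *m submxcol (primal_response mu) i)
      - local_modulus i * B) <= \sum_i local_dual X f A i l'.
  apply: ler_sum => i _; rewrite mxcolK.
  apply: le_trans (local_ascent i l l' (mu i)).
  rewrite lerD2l lerN2 ler_wpM2l ?local_modulus_ge0 // lerD2l.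
  by rewrite ler_wpM2l.
rewrite sumrB big_split /= -mulr_suml in h.
have := ler_wpM2r B0 sum_local_modulus_le.
by move: h; lra.
Qed.

Lemma dual_gap l (mu : 'I_N.+1 -> 'cV[R]_m) (w : R) :
  (forall i, enorm (l - mu i) <= w) ->
  full_lagrangian (primal_response mu) l <= D l + L_D c A / 2 * w ^+ 2.
Proof.
move=> hw; rewrite full_lagrangianE addrAC lerD2r.
have w0 : 0 <= w := le_trans (enorm_ge0 _) (hw ord0).
apply: (@le_trans _ _
    (\sum_i (local_dual X f A i l + local_modulus i * (w ^+ 2 / 2)))).
  apply: ler_sum => i _; rewrite mxcolK; apply: le_trans (local_gap i l (mu i)) _.
  rewrite lerD2l mulrA -[leRHS]mulrAC ler_wpM2l //.
    by rewrite divr_ge0 // local_modulus_ge0.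
  by rewrite ler_sqr ?nnegrE ?enorm_ge0.
rewrite big_split /= lerD2l -mulr_suml [leRHS]mulrAC -[leRHS]mulrA.
by rewrite ler_wpM2r ?sum_local_modulus_le // divr_ge0 ?sqr_ge0.
Qed.

Lemma total_cost_average_le (I : Type) (r : seq I)
    (u : I -> 'cV[R]_(\sum_i n i)) :
  (0 < size r)%N -> (forall k, feasible_region X (u k)) ->
  let avg := (size r)%:R^-1 *: \sum_(k <- r) u k in
  feasible_region X avg /\
  total_cost f avg <= (size r)%:R^-1 * \sum_(k <- r) total_cost f (u k).
Proof.
move=> r0 Xu avg.
have jensen i : X i (submxcol avg i) /\ f i (submxcol avg i)
    <= (size r)%:R^-1 * \sum_(k <- r) f i (submxcol (u k) i).
  rewrite submxcolZ submxcol_sums.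
  have cX := @region_convex _ _ _ _ _ _ _ _ _ pb i.
  have sc := @cost_strongly_convex _ _ _ _ _ _ _ _ _ pb i.
  have c0 := ltW (c_gt0 pb i).
  exact: (strongly_convex_jensen c0 cX sc r0 (fun k => Xu k i)).
split=> [i|]; first by case: (jensen i).
rewrite /total_cost exchange_big /= mulr_sumr; apply: ler_sum => i _.
by case: (jensen i).
Qed.

(** The dual is a pointwise infimum of functions that are affine in the
    multiplier. *)
Lemma dual_average_ge (I : Type) (r : seq I) (u : I -> 'cV[R]_m) :
  (0 < size r)%N ->
  (size r)%:R^-1 * \sum_(i <- r) D (u i)
    <= D ((size r)%:R^-1 *: \sum_(i <- r) u i).
Proof.
move=> r0; set p : R := (size r)%:R; have p0 : 0 < p by rewrite ltr0n.
set l := _ *: _; set x := primal_response (fun=> l).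
have xf : feasible_region X x := primal_response_feasible _.
have -> : D l = p^-1 * \sum_(i <- r) full_lagrangian x (u i).
  rewrite dualE -/x big_split /= big_const_seq count_predT iter_addr_0.
  rewrite -[total_cost f x *+ _]mulr_natr -/p mulrDr mulrCA mulVf ?gt_eqF // mulr1.
  congr (_ + _); rewrite /l dotvZl dotvC dotv_sumr.
  by congr (_ * _); apply: eq_bigr => i _; rewrite dotvC.
rewrite ler_wpM2l ?invr_ge0 ?(ltW p0) //; apply: ler_sum => i _.
exact: dual_le.
Qed.

(** A positive slope would beat, for a small step along [d], the quadratic
    error term of [dual_ascent] without delay. *)
Lemma dual_maximizer_slope l d :
  is_maximizer (@nonneg_orthant R m) D l ->
  (forall t, 0 <= t <= 1 -> lev 0 (l + t *: d)) ->
  dotv d (A *m primal_response (fun=> l) - b) <= 0.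
Proof.
move=> [l0 maxl] feas; set g := dotv _ _; rewrite leNgt; apply/negP => g0.
set K : R := L_D c A * enorm d ^+ 2.
have K0 : 0 <= K by rewrite mulr_ge0 ?sqr_ge0 ?L_D_ge0.
(* This step is at most 1 and satisfies [t * K <= g]. *)
pose t := g / (g + K).
have t0 : 0 < t by rewrite divr_gt0 //; lra.
have t1 : t <= 1 by rewrite ler_pdivrMr; lra.
have tK : t * K <= g by rewrite /t mulrAC ler_pdivrMr; nra.
have t01 : 0 <= t <= 1 by rewrite (ltW t0).
have := @dual_ascent l (l + t *: d) (fun=> l) 0.
rewrite subrr enorm0 => /(_ (fun=> lexx 0)).
rewrite (addrC l) addrK mulr0 addr0 dotvZl enormZ ?(ltW t0) // -/g => h1.
have := maxl _ (feas t t01); rewrite addrC => h2.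
have h3 : t * g - t * (t * K) / 2 <= 0.
  by move: h1 h2; rewrite exprMn /K; lra.
have : t * (t * K) <= t * g by rewrite ler_wpM2l // ltW.
by have := mulr_gt0 t0 g0; lra.
Qed.

(** The slopes of the dual at [lstar] along the coordinate directions show that
    the response to [lstar] is feasible, and the slope along [- lstar] gives
    complementary slackness: the cost of this response is the dual value. *)
Lemma strong_duality xstar lstar :
  is_minimizer (primal_feasible X A b) (total_cost f) xstar ->
  is_maximizer (@nonneg_orthant R m) D lstar ->
  total_cost f xstar = D lstar /\ xstar = primal_response (fun=> lstar).
Proof.
move=> [xf xmin] lmax; have [l0 _] := lmax.
set x := primal_response _; have xX : feasible_region X x.
  exact: primal_response_feasible.
have Axb : lev (A *m x) b.
  move=> j; have := @dual_maximizer_slope lstar (delta_mx j 0) lmax.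
  rewrite -/x => slope; have {slope} : dotv (delta_mx j 0) (A *m x - b) <= 0.
    apply: slope => t /andP[t0 _] i; have := l0 i.
    rewrite !mxE => li; rewrite addr_ge0 // mulr_ge0 // ler0n //.
  rewrite /dotv (bigD1 j) //= [X in _ + X <= _ -> _]big1 => [|i ij].
    by rewrite !mxE !eqxx mul1r addr0 subr_le0.
  by rewrite !mxE (negbTE ij) mul0r.
have slack : 0 <= dotv lstar (A *m x - b).
  rewrite -oppr_le0 -dotvNl; apply: dual_maximizer_slope => // t /andP[_ t1] i.
  by have := l0 i; rewrite !mxE => li; nra.
have FD : total_cost f xstar <= D lstar.
  apply: le_trans (xmin x (conj xX Axb)) _.
  by rewrite dualE -/x /full_lagrangian lerDl.
split; first by apply/le_anti; rewrite FD weak_duality.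
have := dual_growth lstar xf.1; have := lagrangian_le_cost xf l0.
rewrite -/x => h1 h2; apply/eqP; rewrite -subr_eq0; apply/eqP/enorm_eq0.
apply/eqP; rewrite -sqrf_eq0 eq_le sqr_ge0 andbT.
have cF := c_F_gt0.
have : c_F c / 2 * enorm (xstar - x) ^+ 2 <= 0 by lra.
by rewrite pmulr_rle0 //; lra.
Qed.

End DualFunction.
(** * Sums over windows of past steps *)

Section Windows.
Context {R : realType}.
Implicit Types (g s : nat -> R) (w k K : nat).

(** Terms that would have a negative index are left out, in agreement with the
    constant extension of the iterates to negative times. *)
Definition past_window w g k : R :=
  \sum_(j < w | (j < k)%N) g (k - j.+1)%N.

Lemma past_windowS w g k :
  past_window w.+1 g k =
  past_window w g k + (if (w < k)%N then g (k - w.+1)%N else 0).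
Proof. by rewrite /past_window big_mkcond big_ord_recr /= -big_mkcond. Qed.

Lemma past_window_ge0 w g k : (forall j, 0 <= g j) -> 0 <= past_window w g k.
Proof. by move=> g0; apply: sumr_ge0. Qed.

(** Each index belongs to at most [w] windows. *)
Lemma sum_past_window_le w g K : (forall j, 0 <= g j) ->
  \sum_(k < K) past_window w g k <= w%:R * \sum_(k < K) g k.
Proof.
move=> g0; elim: w => [|w IH].
  by rewrite mul0r big1 // => k _; rewrite /past_window big_ord0.
under eq_bigr do rewrite past_windowS.
rewrite big_split /= -natr1 mulrDl mul1r lerD //.
have shift k : \sum_(i < k) (if (w < i)%N then g (i - w.+1)%N else 0) =
    \sum_(i < k - w.+1) g i.
  elim: k => [|k IHk]; first by rewrite !big_ord0.
  rewrite big_ord_recr /= IHk; case: ltnP => wk.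
    by rewrite subSS (_ : k - w = (k - w.+1).+1)%N ?big_ord_recr //; lia.
  by rewrite addr0 (_ : k - w.+1 = k.+1 - w.+1)%N //; lia.
rewrite shift -!(big_mkord xpredT g).
rewrite [leRHS](@big_cat_nat _ _ _ (K - w.+1)) ?leq_subr //=.
by rewrite lerDl sumr_ge0.
Qed.

Lemma past_window_young w s k (t : R) :
  2 * t * past_window w s k
    <= w%:R * t ^+ 2 + past_window w (fun j => s j ^+ 2) k.
Proof.
elim: w => [|w IH].
  by rewrite /past_window !big_ord0 mulr0 mul0r addr0.
rewrite !past_windowS -natr1; case: ifP => _.
  by have := sqr_ge0 (t - s (k - w.+1)%N); nra.
by have := sqr_ge0 t; lra.
Qed.

Lemma past_window_sqr_le w s k :
  past_window w s k ^+ 2 <= w%:R * past_window w (fun j => s j ^+ 2) k.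
Proof.
have [->|w0] := posnP w; first by rewrite /past_window !big_ord0 mul0r expr0n.
have wp : 0 < w%:R :> R by rewrite ltr0n.
(* The mean of the window is the best [t] in Young's inequality. *)
have := past_window_young w s k (past_window w s k / w%:R).
set W := past_window w s k; set V := past_window _ _ _ => h.
have {h} : W ^+ 2 / w%:R <= V.
  have e1 : 2 * (W / w%:R) * W = 2 * (W ^+ 2 / w%:R) by field; lra.
  have e2 : w%:R * (W / w%:R) ^+ 2 = W ^+ 2 / w%:R by field; lra.
  by rewrite e1 e2 in h; lra.
by rewrite ler_pdivrMr // mulrC.
Qed.

Lemma enorm_drift_le d (u : nat -> 'cV[R]_d) w k e : (e <= w)%N ->
  enorm (u k - u (k - e)%N)
    <= past_window w (fun j => enorm (u j.+1 - u j)) k.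
Proof.
elim: w e => [|w IH] e.
  by rewrite leqn0 => /eqP ->; rewrite subn0 subrr enorm0 /past_window big_ord0.
rewrite leq_eqVlt past_windowS => /orP[/eqP ->|]; last first.
  rewrite ltnS => ew; apply: le_trans (IH _ ew) _; rewrite lerDl.
  by case: ifP => // _; apply: enorm_ge0.
case: ltnP => wk; last first.
  by rewrite addr0 (_ : k - w.+1 = k - w)%N; [apply: IH|lia].
have -> : u k - u (k - w.+1)%N =
    (u k - u (k - w)%N) + (u (k - w)%N - u (k - w.+1)%N) by rewrite subrKA.
apply: le_trans (ler_enormD _ _) _; rewrite lerD ?IH //.
by rewrite (_ : k - w = (k - w.+1).+1)%N //; lia.
Qed.

End Windows.

(** * The asynchronous projected gradient iteration *)

Section Run.
Context {R : realType} {N m : nat} {n : 'I_N.+1 -> nat}.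
Unset Implicit Arguments.
Context (X : forall i, set 'cV[R]_(n i)) (f : forall i, 'cV[R]_(n i) -> R).
Set Implicit Arguments.
Context (c : 'I_N.+1 -> R) (A : 'M[R]_(m, \sum_i n i)) (b : 'cV[R]_m).
Context (pb : problem_assumption X f c A b).
Context (xt : forall i, 'cV[R]_m -> 'cV[R]_(n i)) (k0 : nat) (KD : pred nat).
Context (delta : nat -> 'I_N.+1 -> nat) (alpha : R) (lam : nat -> 'cV[R]_m).
Context (run : dual_decomposition_run A b xt k0 KD delta alpha lam).
Context (exact_xt : forall i l, lev 0 l -> xt i l = local_argmin X f A i l).
Context (alpha0 : 0 < alpha).
Implicit Types (z : 'cV[R]_m) (k K : nat).

Local Notation D := (dual X f A b).
Local Notation FL := (full_lagrangian f A b).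
Local Notation L := (L_D c A).
Local Notation xhat := (delayed_primal xt delta lam).
Local Notation nu k := (A *m xhat k - b).

Let s k : R := enorm (lam k.+1 - lam k).
Let W k : R := past_window (2 * k0) s k.
Let V k : R := past_window (2 * k0) (fun j => s j ^+ 2) k.

Let V_ge0 k : 0 <= V k.
Proof. by apply: past_window_ge0 => j; apply: sqr_ge0. Qed.

Let L_ge0 : 0 <= L := L_D_ge0 pb.

Let sumV_le K : \sum_(k < K) V k <= 2 * k0%:R * \sum_(k < K) s k ^+ 2.
Proof.
rewrite -natrM; apply: (@sum_past_window_le _ _ (fun j => s j ^+ 2)) => j.
exact: sqr_ge0.
Qed.

Lemma iterate_ge0 k : lev 0 (lam k).
Proof.
elim: k => [|k IH]; first exact: initial_ge0 run.
by rewrite (dual_update run); case: ifP => // _; apply: pospart_ge0.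
Qed.

Lemma xhatE k :
  xhat k = primal_response X f A (fun i => lam (k - delta k i)%N).
Proof.
rewrite /delayed_primal; apply: eq_mxcol => i.
by rewrite exact_xt //; apply: iterate_ge0.
Qed.

Lemma xhat_feasible k : feasible_region X (xhat k).
Proof. by rewrite xhatE; apply: (primal_response_feasible pb). Qed.

Lemma idle_step k : k \notin KD -> lam k.+1 = lam k.
Proof. by rewrite (dual_update run) => /negbTE ->. Qed.

(** The variational inequality of the projection. *)
Lemma active_step_obtuse k z : k \in KD -> lev 0 z ->
  alpha * dotv (nu k) (z - lam k.+1)
    <= dotv (lam k.+1 - lam k) (z - lam k.+1).
Proof.
move=> kD z0; rewrite -dotvZl -subr_le0 -dotvBl opprB addrCA addrA.
by rewrite (dual_update run) kD; apply: pospart_obtuse.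
Qed.

Lemma delay_drift_le k i : enorm (lam k - lam (k - delta k i)%N) <= W k.
Proof. exact/enorm_drift_le/(delay_bound run). Qed.

Lemma iterate_ascent k :
  D (lam k) + s k ^+ 2 / alpha - L * (s k ^+ 2 / 2 + s k * W k)
    <= D (lam k.+1).
Proof.
have [kD|kD] := boolP (k \in KD); last first.
  have -> : s k = 0 by rewrite /s idle_step // subrr enorm0.
  by rewrite idle_step // expr0n /= !mul0r !addr0 mulr0 subr0.
apply: le_trans (dual_ascent pb (lam k.+1) (delay_drift_le k)).
rewrite -xhatE lerD2r lerD2l ler_pdivrMr // mulrC.
have := active_step_obtuse kD (iterate_ge0 k).
rewrite /s enorm_sqr -(opprB (lam k.+1) (lam k)) !dotvNr (dotvC (nu k)).
lra.
Qed.

(** Summing [iterate_ascent]: the delayed steps in [s k * W k] are split by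
    Young's inequality, and every step then lies in at most [2 * k0] windows. *)
Lemma sum_step_sqr_le (Dsup : R) K :
  (forall l, lev 0 l -> D l <= Dsup) ->
  (1 / alpha - (2 * k0%:R + 1 / 2) * L) * \sum_(k < K) s k ^+ 2
    <= Dsup - D (lam 0).
Proof.
move=> Dub; have ascent : \sum_(k < K) (s k ^+ 2 / alpha
    - L * ((1 / 2 + k0%:R) * s k ^+ 2 + V k / 2)) <= D (lam K) - D (lam 0).
  rewrite -(@telescope_sumr _ 0 K (fun k => D (lam k))) // big_mkord.
  apply: ler_sum => k _; have := iterate_ascent k.
  have := past_window_young (2 * k0) s k (s k).
  rewrite -/(W k) -/(V k) natrM => h1 h2.
  have : L * (s k ^+ 2 / 2 + s k * W k) <=
      L * ((1 / 2 + k0%:R) * s k ^+ 2 + V k / 2) by apply: ler_wpM2l => //; lra.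
  lra.
move: ascent; rewrite sumrB -mulr_suml -mulr_sumr big_split /=.
rewrite -mulr_sumr -mulr_suml.
have := ler_wpM2l L_ge0 (sumV_le K); have := Dub _ (iterate_ge0 K).
lra.
Qed.

(** One step from the current multiplier pays for the gap between the
    Lagrangian at [z] and the dual value, up to the error caused by delays. *)
Lemma lagrangian_gap_step k z : k \in KD -> lev 0 z ->
  2 * alpha * (FL (xhat k) z - D (lam k.+1)) + enorm (lam k.+1 - z) ^+ 2
    <= enorm (lam k - z) ^+ 2 - s k ^+ 2
       + alpha * L * (2 * k0%:R + 1) * (s k ^+ 2 + V k).
Proof.
move=> kD z0.
have drift i : enorm (lam k.+1 - lam (k - delta k i)%N) <= s k + W k.
  rewrite -(subrKA (lam k)); apply: le_trans (ler_enormD _ _) _.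
  by rewrite lerD2l delay_drift_le.
have gap := dual_gap pb drift; rewrite -xhatE in gap.
have delay_sqr : (s k + W k) ^+ 2 <= (2 * k0%:R + 1) * (s k ^+ 2 + V k).
  have := past_window_young (2 * k0) s k (s k).
  have := past_window_sqr_le (2 * k0) s k.
  by rewrite -/(W k) -/(V k) natrM; lra.
have aL : 0 <= alpha * L by rewrite mulr_ge0 // ltW.
have := ler_wpM2l aL delay_sqr; rewrite mulrA.
have a2 : 0 <= 2 * alpha by rewrite mulr_ge0 // ltW.
have := ler_wpM2l a2 gap.
have := active_step_obtuse kD z0.
rewrite (full_lagrangian_shift _ _ _ _ z (lam k.+1)) (dotvC (z - _)).
move=> h1 h2 h3.
have : enorm (lam k - z) ^+ 2 = enorm (lam k.+1 - z) ^+ 2 + s k ^+ 2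
    + 2 * dotv (lam k.+1 - lam k) (z - lam k.+1).
  rewrite -(opprB _ z) dotvNr.
  have -> : lam k - z = (lam k.+1 - z) - (lam k.+1 - lam k).
    by rewrite opprB [RHS]addrC subrKA.
  by rewrite enormB_sqr -/(s k) (dotvC _ (lam k.+1 - z)); ring.
lra.
Qed.

Lemma lagrangian_gap_sum K z : lev 0 z ->
  alpha * L * (2 * k0%:R + 1 / 2) <= 1 -> alpha * L <= 1 / 2 ->
  2 * alpha * \sum_(k < K | (k : nat) \in KD) (FL (xhat k) z - D (lam k.+1))
    + enorm (lam K - z) ^+ 2
    <= enorm (lam 0 - z) ^+ 2 + 8 * k0%:R * \sum_(k < K) s k ^+ 2.
Proof.
move=> z0 aL1 aL2; have aL : 0 <= alpha * L by rewrite mulr_ge0 // ltW.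
have step : 2 * alpha
      * \sum_(k < K | (k : nat) \in KD) (FL (xhat k) z - D (lam k.+1))
    + enorm (lam K - z) ^+ 2 <= enorm (lam 0 - z) ^+ 2
    + (alpha * L * (2 * k0%:R + 1) * \sum_(k < K) (s k ^+ 2 + V k)
       - \sum_(k < K) s k ^+ 2).
  elim: K => [|k IH]; first by rewrite !big_ord0; lra.
  rewrite big_mkcond !big_ord_recr /= -big_mkcond.
  case: ifP => kD; first by have := lagrangian_gap_step kD z0; lra.
  rewrite (idle_step (negbT kD)).
  have -> : s k = 0 by rewrite /s (idle_step (negbT kD)) subrr enorm0.
  have : 0 <= alpha * L * (2 * k0%:R + 1) * V k.
    by rewrite mulr_ge0 // mulr_ge0 // addr_ge0 // mulr_ge0.
  lra.
apply: le_trans step _; rewrite lerD2l big_split /=.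
set S := \sum_(k < K) s k ^+ 2.
have S0 : 0 <= S by apply: sumr_ge0 => k _; apply: sqr_ge0.
have k0R : 0 <= k0%:R :> R by [].
set V' := \sum_(k < K) V k; set a := alpha * L in aL aL1 aL2 *.
have hV : V' <= 2 * k0%:R * S := sumV_le K.
have h1 : a * (2 * k0%:R + 1) * (S + V') <=
    a * (2 * k0%:R + 1) * ((2 * k0%:R + 1) * S).
  by apply: ler_wpM2l; [rewrite mulr_ge0 // addr_ge0|lra].
(* [(2 * k0 + 1) ^+ 2 = (2 * k0 + 1 / 2) * (2 * k0) + 3 * k0 + 1]; each of the
   step size conditions bounds one part. *)
have h2 : a * (2 * k0%:R + 1) * (2 * k0%:R + 1) <= 8 * k0%:R + 1.
  have -> : a * (2 * k0%:R + 1) * (2 * k0%:R + 1) =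
    a * (2 * k0%:R + 1 / 2) * (2 * k0%:R) + a * (3 * k0%:R + 1) by field.
  have : a * (2 * k0%:R + 1 / 2) * (2 * k0%:R) <= 1 * (2 * k0%:R).
    by rewrite ler_wpM2r // mulr_ge0.
  have : a * (3 * k0%:R + 1) <= 1 / 2 * (3 * k0%:R + 1).
    by rewrite ler_wpM2r // addr_ge0 // mulr_ge0.
  lra.
by have := ler_wpM2r S0 h2; move: h1; rewrite mulrA; lra.
Qed.

(** The projection only increases coordinates, so that the summed
    constraint violation stays below the multiplier. *)
Lemma total_violation_le K :
  lev (alpha *: \sum_(k < K | (k : nat) \in KD) nu k) (lam K).
Proof.
elim: K => [|k IH] j.
  by rewrite big_ord0 scaler0; apply: iterate_ge0.
rewrite big_mkcond big_ord_recr /= -big_mkcond.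
have := IH j; case: ifP => kD; last by rewrite addr0 (idle_step (negbT kD)).
have : (lam k + alpha *: nu k) j 0 <= lam k.+1 j 0.
  by rewrite (dual_update run) kD; apply: lev_pospart.
set S := \sum_(_ < k | _) _; move=> h1 h2.
by apply: le_trans h1; rewrite (scalerDr alpha S) [leLHS]mxE [leRHS]mxE lerD2r.
Qed.

End Run.

(** * Averages over the active slots *)

Section Slots.
Context (k0 : nat) (KD : pred nat).

Lemma big_active_slots (T : nmodType) (F : nat -> T) k :
  \sum_(kappa <- active_slots KD k) F kappa =
  \sum_(kappa < k.+1 | (kappa : nat) \in KD) F kappa.
Proof.
rewrite /active_slots big_filter -(big_mkord (fun kappa => kappa \in KD) F).
by rewrite /index_iota subn0.
Qed.

(** The intervals of length [k0] that start at the active slots cover the time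
    from 0 to [k]. *)
Lemma active_slots_frequent k :
  (forall j, exists kappa,
     [/\ kappa \in KD, (kappa <= j)%N & (j <= kappa + k0)%N]) ->
  (k.+1 <= size (active_slots KD k) * k0.+1)%N.
Proof.
move=> act; pose cover := [seq iota kappa k0.+1 | kappa <- active_slots KD k].
have <- : size (flatten cover) = (size (active_slots KD k) * k0.+1)%N.
  rewrite size_flatten /shape -map_comp /cover.
  elim: (active_slots KD k) => //= kappa r ->.
  by rewrite size_iota mulSn.
rewrite -[k.+1](size_iota 0); apply: uniq_leq_size; first exact: iota_uniq.
move=> j; rewrite mem_iota add0n ltnS => /andP[_ jk].
have [kappa [kD kj jk0]] := act j.
apply/flattenP; exists (iota kappa k0.+1); last by rewrite mem_iota; lia.
apply/mapP; exists kappa => //; rewrite mem_filter kD mem_iota /=; lia.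
Qed.

End Slots.

(** The extended quotient is [+oo] at [x = 0], where the conclusion is
    [0 < 1]. *)
Lemma lt_einv_mul (R : realType) (a x : R) :
  0 <= x -> (a%:E < 1 / x%:E)%E -> a * x < 1.
Proof.
rewrite le_eqVlt => /orP[/eqP <-|x0]; first by rewrite mulr0 ltr01.
rewrite mul1e inver gt_eqF // lte_fin => h.
by rewrite -ltr_pdivlMr // div1r.
Qed.
Section SlotAverage.
Context {R : realType} {d : nat} (KD : pred nat).

Lemma slot_average_shift (u : nat -> 'cV[R]_d) v k :
  (0 < size (active_slots KD k))%N ->
  slot_average KD k u - v = slot_average KD k (fun kappa => u kappa - v).
Proof.
move=> p0; rewrite /slot_average sumrB big_const_seq count_predT iter_addr_0.
rewrite scalerBr -[v *+ _]scaler_nat scalerA mulVf ?scale1r //.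
by rewrite pnatr_eq0 -lt0n.
Qed.

Lemma mulmx_slot_average p (B : 'M[R]_(p, d)) (u : nat -> 'cV[R]_d) k :
  B *m slot_average KD k u = slot_average KD k (fun kappa => B *m u kappa).
Proof. by rewrite /slot_average -scalemxAr mulmx_sumr. Qed.

End SlotAverage.

(** * Rates of convergence of the averages *)

Theorem corollary10 (R : realType) (N m : nat) (n : 'I_N.+1 -> nat)
    (X : forall i, set 'cV[R]_(n i)) (f : forall i, 'cV[R]_(n i) -> R)
    (c : 'I_N.+1 -> R) (A : 'M[R]_(m, \sum_i n i)) (b : 'cV[R]_m)
    (xstar : 'cV[R]_(\sum_i n i)) (lamstar : 'cV[R]_m)
    (xt : forall i, 'cV[R]_m -> 'cV[R]_(n i)) (eps : 'I_N.+1 -> R)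
    (k0 : nat) (KD : pred nat) (Ka : 'I_N.+1 -> pred nat)
    (delta : nat -> 'I_N.+1 -> nat) (alpha : R) (lam : nat -> 'cV[R]_m) :
  problem_assumption X f c A b ->
  is_minimizer (primal_feasible X A b) (total_cost f) xstar ->
  is_maximizer (@nonneg_orthant R m) (dual X f A b) lamstar ->
  asynchrony_assumption k0 KD Ka ->
  inexactness_assumption X f A xt eps ->
  \sum_i eps i = 0 ->
  dual_decomposition_run A b xt k0 KD delta alpha lam ->
  (* in \bar R, so that 1 / 0 = +oo when A = 0 *)
  (0 < alpha%:E < Order.min (1 / ((2 * k0%:R + 1 / 2) * L_D c A)%R%:E)
                            (1 / (2 * L_D c A)%R%:E))%E ->
  let F := total_cost f in
  let D := dual X f A b in
  let Fstar := F xstar in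
  let Dstar := D lamstar in
  let D0 := D (lam 0) in
  let xbar k := slot_average KD k (delayed_primal xt delta lam) in
  let lambar_next k := slot_average KD k (fun kappa => lam kappa.+1) in
  let gamma := 1 / alpha - (2 * k0%:R + 1 / 2) * L_D c A in
  let M1 := (k0%:R + 1) / alpha *
    (2 * enorm lamstar + enorm (lam 0)
     + 2 * Num.sqrt (2 * k0%:R * (Dstar - D0) / gamma)) in
  let N1 := (k0%:R + 1) / (2 * alpha) *
    (enorm (lam 0) ^+ 2 + 8 * k0%:R * (Dstar - D0) / gamma) in
  let N1' := (k0%:R + 1) / (2 * alpha) *
    (enorm (lam 0 - lamstar) ^+ 2 + 8 * k0%:R * (Dstar - D0) / gamma) in
  forall k : nat,
    [/\ enorm (pospart (A *m xbar k - b)) <= M1 / (k%:R + 1),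
        - (M1 * enorm lamstar / (k%:R + 1)) <= F (xbar k) - Fstar
          <= N1 / (k%:R + 1),
        0 <= Dstar - D (lambar_next k) <= N1' / (k%:R + 1) &
        enorm (xbar k - xstar) ^+ 2
          <= 2 * (N1 + enorm lamstar * M1) / (c_F c * (k%:R + 1))].
Proof.
move=> pb xmin lmax asyn inx eps0 run /andP[al0 alub] F D Fstar Dstar D0 xbar
  lambar_next gamma M1 N1 N1' k.
have alpha0 : 0 < alpha by rewrite lte_fin in al0.
have exact_xt i l : lev 0 l -> xt i l = local_argmin X f A i l.
  by move=> l0; apply: inexact_exactE l0; [exact: pb|exact: inx|exact: eps0].
have L0 := L_D_ge0 pb; have cF0 := c_F_gt0 pb.
move: alub; rewrite lt_min => /andP[al1 al2].
have k0R : 0 <= k0%:R :> R by [].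
have kR : 0 < k%:R + 1 :> R by rewrite ltr_wpDl.
have w0 : 0 <= 2 * k0%:R + 1 / 2 :> R by rewrite addr_ge0 // mulr_ge0.
have {}al1 : alpha * L_D c A * (2 * k0%:R + 1 / 2) <= 1 /\ 0 < gamma.
  move: al1; rewrite /gamma; set x := (2 * k0%:R + 1 / 2) * L_D c A => al1.
  have x0 : 0 <= x by rewrite mulr_ge0.
  have ax : alpha * x < 1 by apply: lt_einv_mul al1.
  split; first by rewrite -mulrA (mulrC (L_D c A)) ltW.
  by rewrite subr_gt0 ltr_pdivlMr // mulrC.
case: al1 => al1 gamma0.
have {}al2 : alpha * L_D c A <= 1 / 2.
  have x0 : 0 <= 2 * L_D c A by rewrite mulr_ge0.
  by have := lt_einv_mul x0 al2; lra.
have [lstar0 Dmax] := lmax; have lam0 : lev 0 (lam 0) := iterate_ge0 run 0.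
have D0le : D0 <= Dstar := Dmax _ lam0.
have [strong xstarE] := strong_duality pb xmin lmax.
have FD : Fstar = Dstar := strong.
(* [Q] bounds the sum of the squared steps, [E] the total error caused by the
   delays. *)
pose Q := (Dstar - D0) / gamma.
have Q0 : 0 <= Q by apply: divr_ge0 (ltW gamma0); rewrite subr_ge0.
pose E := 8 * k0%:R * Q.
have E0 : 0 <= E by apply: mulr_ge0 Q0; rewrite mulr_ge0.
have gap z : lev 0 z -> 2 * alpha
    * \sum_(kappa <- active_slots KD k)
        (full_lagrangian f A b (delayed_primal xt delta lam kappa) z
         - D (lam kappa.+1))
    + enorm (lam k.+1 - z) ^+ 2 <= enorm (lam 0 - z) ^+ 2 + E.
  move=> z0; rewrite big_active_slots.
  apply: le_trans (lagrangian_gap_sum pb run exact_xt alpha0 k.+1 z0 al1 al2) _.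
  rewrite lerD2l /E ler_wpM2l ?mulr_ge0 // /Q ler_pdivlMr // mulrC.
  by apply: (sum_step_sqr_le pb run exact_xt alpha0 k.+1).
set r := active_slots KD k in gap.
have rsize : (k.+1 <= size r * k0.+1)%N.
  exact: active_slots_frequent (coordinator_acts asyn).
have r0 : (0 < size r)%N by case: (size r) rsize.
set p : R := (size r)%:R; have p0 : 0 < p by rewrite ltr0n.
have pV0 : 0 <= p^-1 by rewrite invr_ge0 ltW.
have alpha_ge0 := ltW alpha0.
(* The number of active slots turns [p^-1] into the rate of the theorem. *)
have pinv_le : p^-1 <= (k0%:R + 1) / (k%:R + 1).
  by rewrite ler_pdivlMr // ler_pdivrMl // !natr1 -natrM ler_nat.
have scale_le (B : R) : 0 <= B -> p^-1 * B <= (k0%:R + 1) * B / (k%:R + 1).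
  by move=> B0; rewrite mulrAC ler_wpM2r.
have N1_ge (B e : R) : 0 <= e -> 2 * alpha * B <= e ->
    p^-1 * B <= (k0%:R + 1) / (2 * alpha) * e / (k%:R + 1).
  move=> e0 Be; apply: (@le_trans _ _ (p^-1 * (e / (2 * alpha)))).
    by rewrite ler_wpM2l ?invr_ge0 ?(ltW p0) // ler_pdivlMr ?mulr_gt0 // mulrC.
  apply: le_trans (scale_le _ _) _; first by rewrite divr_ge0 // mulr_ge0 // ltW.
  by rewrite -!mulrA (mulrCA e).
have [xbarX Fxbar] := total_cost_average_le pb r0
  (xhat_feasible pb run exact_xt).
rewrite -/p -/(slot_average _ _ _) -/(xbar k) in xbarX Fxbar.
pose viol := enorm (pospart (A *m xbar k - b)).
(* At [z = lamstar] the Lagrangian gaps are nonnegative, so the squared distance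
   to [lamstar] cannot grow by more than [E]. *)
have lam_dist : enorm (lam k.+1)
    <= 2 * enorm lamstar + enorm (lam 0) + 2 * Num.sqrt (2 * k0%:R * Q).
  set q := Num.sqrt _; have q0 : 0 <= q by apply: sqrtr_ge0.
  have q2 : q ^+ 2 = 2 * k0%:R * Q.
    by rewrite sqr_sqrtr //; apply: mulr_ge0 Q0; rewrite mulr_ge0.
  have h : enorm (lam k.+1 - lamstar) <= enorm (lam 0 - lamstar) + 2 * q.
    apply: enorm_le_sqr; first by rewrite addr_ge0 ?enorm_ge0 // mulr_ge0.
    have := gap _ lstar0.
    have : 0 <= 2 * alpha * \sum_(kappa <- r)
        (full_lagrangian f A b (delayed_primal xt delta lam kappa) lamstar
         - D (lam kappa.+1)).
      rewrite mulr_ge0 ?(ltW alpha0) ?mulr_ge0 // ?(ltW alpha0) //.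
      apply: sumr_ge0 => kappa _; rewrite subr_ge0.
      apply: le_trans (Dmax _ (iterate_ge0 run _)) _.
      exact: (dual_le pb lamstar (xhat_feasible pb run exact_xt kappa)).
    have : 0 <= enorm (lam 0 - lamstar) * q by rewrite mulr_ge0 ?enorm_ge0.
    by rewrite /E; lra.
  have := ler_enormD (lam k.+1 - lamstar) lamstar; rewrite subrK.
  have := ler_enormD (lam 0) (- lamstar); rewrite enormN.
  lra.
have M1E : viol <= M1 / (k%:R + 1).
  have viol_le : viol <= p^-1 * (enorm (lam k.+1) / alpha).
    have -> : p^-1 * (enorm (lam k.+1) / alpha) =
        enorm ((p^-1 / alpha) *: lam k.+1).
      by rewrite enormZ; [ring|exact: divr_ge0].
    apply: enorm_pospart_le => j.
      have := iterate_ge0 run k.+1 j; rewrite !mxE; apply: mulr_ge0.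
      exact: divr_ge0.
    rewrite mulmx_slot_average slot_average_shift // /slot_average -/r -/p.
    have := total_violation_le run k.+1 j.
    rewrite -(big_active_slots KD
      (fun kappa => A *m delayed_primal xt delta lam kappa - b)) -/r.
    set S := \sum_(_ <- r) _; rewrite mxE => h.
    rewrite [leLHS]mxE [leRHS]mxE -mulrA ler_wpM2l ?invr_ge0 ?(ltW p0) //.
    by rewrite mulrC ler_pdivlMr // mulrC.
  apply: le_trans viol_le _.
  apply: le_trans (scale_le _ _) _; first by rewrite divr_ge0 ?enorm_ge0 // ltW.
  rewrite ler_wpM2r ?invr_ge0 ?(ltW kR) // /M1 mulrA mulrAC.
  rewrite ler_wpM2l ?divr_ge0 ?addr_ge0 // ?(ltW alpha0) //.
  by move: lam_dist; rewrite /Q mulrA.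
(* Only the positive part of the residual counts against [lamstar >= 0]. *)
have slack_le : dotv lamstar (A *m xbar k - b) <= enorm lamstar * (M1 / (k%:R + 1)).
  apply: (@le_trans _ _ (dotv lamstar (pospart (A *m xbar k - b)))).
    apply: ler_sum => j _; rewrite ler_wpM2l ?lev_pospart //.
    by have := lstar0 j; rewrite mxE.
  apply: le_trans (dotv_le_enorm _ _) _.
  by rewrite ler_wpM2l ?enorm_ge0.
have growth := dual_growth pb lamstar xbarX; rewrite -xstarE in growth.
have Fupper : F (xbar k) - Fstar <= N1 / (k%:R + 1).
  apply: (@le_trans _ _ (p^-1 * \sum_(kappa <- r)
      (full_lagrangian f A b (delayed_primal xt delta lam kappa) 0
       - D (lam kappa.+1)))); last first.
    rewrite /N1 -(mulrA _ (Dstar - D0)) -/Q -/E; apply: N1_ge.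
      by rewrite addr_ge0 ?sqr_ge0.
    have := gap 0 (fun=> lexx _); rewrite !subr0.
    by have := sqr_ge0 (enorm (lam k.+1)); lra.
  rewrite sumrB mulrBr; apply: lerB.
    by under [X in _ <= _ * X]eq_bigr do rewrite full_lagrangian0.
  rewrite ler_pdivrMl // mulr_natl -[leRHS]iter_addr_0 -count_predT -big_const_seq.
  apply: ler_sum => kappa _.
  exact: (weak_duality pb xmin.1 (iterate_ge0 run _)).
have Flower : Dstar + c_F c / 2 * enorm (xbar k - xstar) ^+ 2
    <= F (xbar k) + enorm lamstar * (M1 / (k%:R + 1)).
  by apply: le_trans growth _; rewrite lerD2l.
split=> //.
- rewrite Fupper andbT FD.
  have : 0 <= c_F c / 2 * enorm (xbar k - xstar) ^+ 2.
    by apply: mulr_ge0 (sqr_ge0 _); rewrite divr_ge0 // ltW.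
  have -> : M1 * enorm lamstar / (k%:R + 1) = enorm lamstar * (M1 / (k%:R + 1)).
    by rewrite mulrAC mulrC.
  lra.
- have lbar0 : lev 0 (lambar_next k).
    move=> j; rewrite !mxE mulr_ge0 ?invr_ge0 // summxE sumr_ge0 // => kappa _.
    by have := iterate_ge0 run kappa.+1 j; rewrite mxE.
  rewrite subr_ge0 (Dmax _ lbar0) /=.
  apply: (@le_trans _ _ (p^-1 * \sum_(kappa <- r)
      (full_lagrangian f A b (delayed_primal xt delta lam kappa) lamstar
       - D (lam kappa.+1)))); last first.
    rewrite /N1' -(mulrA _ (Dstar - D0)) -/Q -/E; apply: N1_ge.
      by rewrite addr_ge0 ?sqr_ge0.
    have := gap _ lstar0.
    by have := sqr_ge0 (enorm (lam k.+1 - lamstar)); lra.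
  rewrite sumrB mulrBr; apply: lerB; last exact: (dual_average_ge pb _ r0).
  rewrite ler_pdivlMl // mulr_natl -[leLHS]iter_addr_0 -count_predT -big_const_seq.
  apply: ler_sum => kappa _.
  exact: (dual_le pb lamstar (xhat_feasible pb run exact_xt kappa)).
- rewrite ler_pdivlMr ?mulr_gt0 //.
  have h : c_F c / 2 * enorm (xbar k - xstar) ^+ 2
      <= (N1 + enorm lamstar * M1) / (k%:R + 1).
    by rewrite mulrDl -mulrA; move: Fupper; rewrite FD; lra.
  rewrite ler_pdivlMr // in h; lra.
Qed.
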